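(* Let $A$ be any real function of class at least $C^2$ on an open interval $I\subseteq\mathbb R$, and consider the three-dimensional metric, with coordinates $(u,r,\varphi)$ and $r\in I$, $$ds^2=-2e^{A(r)}\,du\,dr+e^{2A(r)}\,d\varphi^2 .$$ Let $\phi=\phi(r)$ be a real scalar field of class at least $C^1$, independent of $u$ and $\varphi$, satisfying $$\tfrac12\,\phi'(r)^2=-A''(r)\qquad\text{for all } r\in I.$$ Then the metric and $\phi$ solve the field equations of Einstein-dilaton gravity with vanishing scalar potential, $V(\phi)=0$.
   Context: The field equations of three-dimensional Einstein-dilaton gravity with potential $V$ are $$R_{\mu\nu}-\tfrac12 g_{\mu\nu}R=\tfrac12\partial_\mu\phi\,\partial_\nu\phi-\tfrac14(\partial\phi)^2g_{\mu\nu}-\tfrac12V(\phi)g_{\mu\nu},\qquad \nabla^2\phi=V'(\phi),$$ where $R_{\mu\nu}$ and $R$ are the Ricci tensor and Ricci scalar of the metric $g_{\mu\nu}$, $(\partial\phi)^2=g^{\mu\nu}\partial_\mu\phi\,\partial_\nu\phi$, and $\nabla^2\phi=\frac{1}{\sqrt{-g}}\,\partial_\mu\big(\sqrt{-g}\,g^{\mu\nu}\partial_\nu\phi\big)$ with $g=\det(g_{\mu\nu})$. Here they are taken with $V=0$. Primes on $A$ and $\phi$ denote derivatives with respect to $r$. The coordinate $\varphi$ is distinct from the scalar field $\phi$. *)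

(* Defs.v *)
From HB Require Import structures.
From mathcomp Require Import all_boot all_order all_algebra.
From mathcomp Require Import all_classical all_reals all_analysis.
Import Order.TTheory GRing.Theory Num.Theory.
Import numFieldNormedType.Exports.

Set Implicit Arguments.
Unset Strict Implicit.
Unset Printing Implicit Defensive.

Local Open Scope ring_scope.
Local Open Scope classical_set_scope.

(* [D] is meant to be open, so that two-sided derivability and continuity at
   each point of [D] are the right notions. *)
Definition Ck_on (R : realType) (k : nat) (D : set R) (f : R -> R) : Prop :=
  (forall (j : nat) (r : R), (j < k)%N -> D r -> derivable f^`(j) r 1) /\
  (forall (j : nat) (r : R), (j <= k)%N -> D r -> {for r, continuous f^`(j)}).

Section Geometry.
Variable R : realType.

Definition spacetime := 'rV[R]_3.
Definition dir (mu : 'I_3) : spacetime := delta_mx 0 mu.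

Definition partial (mu : 'I_3) (f : spacetime -> R) (x : spacetime) : R :=
  'D_(dir mu) f x.

Variable g : spacetime -> 'M[R]_3.

Definition ginv (x : spacetime) : 'M[R]_3 := invmx (g x).

Definition sqrt_det (x : spacetime) : R := Num.sqrt (- \det (g x)).

(* [christoffel rho mu nu] is the Christoffel symbol with upper index [rho]. *)
Definition christoffel (rho mu nu : 'I_3) (x : spacetime) : R :=
  2^-1 * \sum_(s < 3) ginv x rho s *
    (partial mu (fun y => g y s nu) x
     + partial nu (fun y => g y s mu) x
     - partial s (fun y => g y mu nu) x).

(* Sign convention: R_{mu nu} = d_rho Gamma^rho_{mu nu} - ..., for which round
   spheres have positive curvature. *)
Definition ricci (mu nu : 'I_3) (x : spacetime) : R :=
  \sum_(rho < 3) (partial rho (christoffel rho mu nu) x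
                  - partial nu (christoffel rho mu rho) x)
  + \sum_(rho < 3) \sum_(s < 3)
      (christoffel rho rho s x * christoffel s mu nu x
       - christoffel rho nu s x * christoffel s mu rho x).

Definition scalar_curvature (x : spacetime) : R :=
  \sum_(mu < 3) \sum_(nu < 3) ginv x mu nu * ricci mu nu x.

Variables (V : R -> R) (phi : spacetime -> R).

Definition grad_sq (x : spacetime) : R :=
  \sum_(mu < 3) \sum_(nu < 3)
     ginv x mu nu * partial mu phi x * partial nu phi x.

Definition flux (mu : 'I_3) (x : spacetime) : R :=
  \sum_(nu < 3) sqrt_det x * ginv x mu nu * partial nu phi x.

Definition box (x : spacetime) : R :=
  (sqrt_det x)^-1 * \sum_(mu < 3) partial mu (flux mu) x.

(* ['D_v f x], [invmx], [Num.sqrt] and [^-1] are total functions with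
   conventional values outside their natural domain; this says that every one
   of their uses in the field equations at [x] is a genuine one. *)
Definition well_defined_at (x : spacetime) : Prop :=
  [/\ (g x)^T = g x /\ \det (g x) < 0,
      forall mu s t : 'I_3, derivable (fun y => g y s t) x (dir mu),
      forall mu rho s t : 'I_3, derivable (christoffel rho s t) x (dir mu),
      (forall mu : 'I_3, derivable phi x (dir mu)) /\
      (forall mu : 'I_3, derivable (flux mu) x (dir mu))
    & derivable V (phi x) 1].

Definition einstein_eq_at (x : spacetime) : Prop :=
  forall mu nu : 'I_3,
    ricci mu nu x - 2^-1 * g x mu nu * scalar_curvature x =
    2^-1 * partial mu phi x * partial nu phi x
    - 4^-1 * grad_sq x * g x mu nu
    - 2^-1 * V (phi x) * g x mu nu.

Definition dilaton_eq_at (x : spacetime) : Prop := box x = V^`() (phi x).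

Definition einstein_dilaton_solution (U : set spacetime) : Prop :=
  forall x : spacetime, U x ->
    [/\ well_defined_at x, einstein_eq_at x & dilaton_eq_at x].

End Geometry.

(* Coordinates (u, r, varphi). *)
Definition iu : 'I_3 := @Ordinal 3 0 isT.
Definition ir : 'I_3 := @Ordinal 3 1 isT.
Definition ivarphi : 'I_3 := @Ordinal 3 2 isT.

Definition rcoord (R : realType) (x : spacetime R) : R := x 0 ir.

(* Component matrix of the symmetrised product dx^mu dx^nu, as in a line
   element; off the diagonal, c dx^mu dx^nu contributes c/2 to each of
   g_{mu nu} and g_{nu mu}. *)
Definition dxdx (R : realType) (mu nu : 'I_3) : 'M[R]_3 :=
  2^-1 *: (delta_mx mu nu + delta_mx nu mu).

Definition dilaton_metric (R : realType) (A : R -> R) (x : spacetime R) : 'M[R]_3 :=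
  (- 2 * expR (A (rcoord x))) *: dxdx R iu ir
  + expR (2 * A (rcoord x)) *: dxdx R ivarphi ivarphi.

(* Main.v *)
(** Every component depends on [r] alone, so a partial derivative is either [0]
    or an ordinary derivative in [r].  The only nonzero Christoffel symbols are
    [Gamma^r_rr = Gamma^varphi_(r varphi) = A'] and
    [Gamma^u_(varphi varphi) = A' e^A]; hence the Ricci tensor has the single
    component [R_rr = - A''].  As [g^rr = 0], both the scalar curvature and
    [(d phi)^2] vanish, and the Einstein equations reduce to the constraint.
    The dilaton equation is trivial: the only component of the flux is
    [- e^A phi'] along [u], on which it does not depend, which is why a [C^1]
    scalar field suffices. *)

Require Import Defs.
From HB Require Import structures.
From mathcomp Require Import all_boot all_order all_algebra.
From mathcomp Require Import all_classical all_reals all_analysis.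
From mathcomp Require Import ring.
Import Order.TTheory GRing.Theory Num.Theory.
Import numFieldNormedType.Exports.

Local Open Scope ring_scope.
Local Open Scope classical_set_scope.

(** * Index bookkeeping in dimension three *)

Lemma ord3_ind (P : 'I_3 -> Prop) : P iu -> P ir -> P ivarphi -> forall i, P i.
Proof.
move=> Pu Pr Pv [[|[|[|//]]] i3].
- by rewrite (_ : Ordinal i3 = iu) //; exact: val_inj.
- by rewrite (_ : Ordinal i3 = ir) //; exact: val_inj.
- by rewrite (_ : Ordinal i3 = ivarphi) //; exact: val_inj.
Qed.

Lemma sum_ord3 (V : nmodType) (F : 'I_3 -> V) :
  \sum_(i < 3) F i = F iu + F ir + F ivarphi.
Proof.
rewrite !big_ord_recr /= big_ord0 add0r.
by congr (F _ + F _ + F _); exact: val_inj.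
Qed.

Lemma det3 (T : comPzRingType) (M : 'M[T]_3) :
  \det M = M iu iu * (M ir ir * M ivarphi ivarphi - M ir ivarphi * M ivarphi ir)
         - M iu ir * (M ir iu * M ivarphi ivarphi - M ir ivarphi * M ivarphi iu)
         + M iu ivarphi * (M ir iu * M ivarphi ir - M ir ir * M ivarphi iu).
Proof.
(* Reading the entries through natural-number indices identifies the different ordinal terms that
   the cofactor expansions produce for one index, so that [ring] sees equal atoms. *)
have [N MN] : exists N : nat -> nat -> T, forall i j, M i j = N i j.
  by exists (fun i j => M (inord i) (inord j)) => i j; rewrite !inord_val.
rewrite (expand_det_row M iu) sum_ord3 /cofactor.
rewrite !(expand_det_row _ ord0) !big_ord_recl !big_ord0 /cofactor !det_mx11 !mxE.
by rewrite !MN /= /bump /=; ring.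
Qed.

(** * Partial derivatives of functions of r *)

Section RadialFunctions.
Variable R : realType.
Implicit Types (x : spacetime R) (f : R -> R) (mu : 'I_3).

Lemma rcoord_dir mu x (h : R) :
  rcoord (h *: dir R mu + x) = h * (mu == ir)%:R + rcoord x.
Proof. by rewrite /rcoord /dir !mxE eqxx eq_sym. Qed.

(** Along r the two difference quotients coincide, and along the other directions the quotient is
    identically 0. The equality is therefore one of limits, valid for every [f], default values
    included. *)
Lemma partial_radial f mu x :
  partial mu (fun y => f (rcoord y)) x = (mu == ir)%:R * derive1 f (rcoord x).
Proof.
rewrite /partial /derive /derive1 /=; case: (eqVneq mu ir) => [->|mu_r].
  by rewrite mul1r; under eq_fun do rewrite rcoord_dir eqxx mulr1.
rewrite mul0r [X in lim (X @ _)](_ : _ = cst 0); first exact: lim_cst.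
apply/funext => h /=.
by rewrite rcoord_dir (negbTE mu_r) mulr0 add0r subrr scaler0.
Qed.

Lemma derivable_radial f mu x : (mu == ir -> derivable f (rcoord x) 1) ->
  derivable (fun y : spacetime R => f (rcoord y)) x (dir R mu).
Proof.
rewrite /derivable /=; case: (eqVneq mu ir) => [-> /(_ isT)|mu_r _].
  under [X in cvg (X @ _) -> _]eq_fun do rewrite /= [_ *: 1]mulr1.
  by under [X in _ -> cvg (X @ _)]eq_fun do rewrite /= rcoord_dir eqxx mulr1.
rewrite (_ : (fun h => _) = cst 0); first exact: is_cvg_cst.
apply/funext => h /=.
by rewrite rcoord_dir (negbTE mu_r) mulr0 add0r subrr scaler0.
Qed.

Lemma near_rcoord (I : set R) x : open I -> I (rcoord x) ->
  \forall y \near x, I (rcoord y).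
Proof.
move=> openI Ix; apply: (@coord_continuous R _ _ 0 ir x).
exact: open_nbhs_nbhs.
Qed.

End RadialFunctions.

(** * The metric, its determinant and its inverse *)

Section DilatonMetric.
Variables (R : realType) (A : R -> R).
Implicit Types (x : spacetime R) (rho mu nu : 'I_3).

Definition lightlike_pair mu nu : bool :=
  ((mu == iu) && (nu == ir)) || ((mu == ir) && (nu == iu)).

(** Indicators give all entries one formula, which index-by-index case analysis turns into a [field]
    identity. *)
Definition metric_entry mu nu (r : R) : R :=
  (- (lightlike_pair mu nu)%:R + ((mu == ivarphi) && (nu == ivarphi))%:R * expR (A r))
  * expR (A r).

Lemma dilaton_metricE x mu nu :
  dilaton_metric A x mu nu = metric_entry mu nu (rcoord x).
Proof.
rewrite /dilaton_metric /dxdx /metric_entry mulr_natl mulr2n expRD !mxE.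
by elim/ord3_ind: mu; elim/ord3_ind: nu => /=; field.
Qed.

Lemma det_dilaton_metric x : \det (dilaton_metric A x) = - expR (A (rcoord x)) ^+ 4.
Proof. by rewrite det3 !dilaton_metricE /metric_entry /=; ring. Qed.

Lemma ginv_dilaton_metric x mu nu :
  ginv (dilaton_metric A) x mu nu =
  (- (lightlike_pair mu nu)%:R
   + ((mu == ivarphi) && (nu == ivarphi))%:R / expR (A (rcoord x)))
  / expR (A (rcoord x)).
Proof.
pose e := expR (A (rcoord x)); have e0 : e != 0 by rewrite gt_eqF ?expR_gt0.
pose M : 'M[R]_3 := \matrix_(i, j) ((- (lightlike_pair i j)%:R
   + ((i == ivarphi) && (j == ivarphi))%:R / e) / e).
(* A one-sided inverse suffices: it makes the metric a unit, so [invmx] is the true inverse and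
   equals [M]. *)
suff gM : dilaton_metric A x *m M = 1%:M.
  have [gu _] := mulmx1_unit gM.
  by rewrite /ginv -[invmx _]mulmx1 -gM mulKmx // mxE.
apply/matrixP => i j; rewrite mxE sum_ord3 !dilaton_metricE /metric_entry -/e !mxE.
by elim/ord3_ind: i; elim/ord3_ind: j => /=; field.
Qed.

(** Metric entries ([f] = e^A) and Christoffel symbols ([f] = A') share this shape, so one product
    rule serves both. *)
Lemma is_derive_affine_expR (a b r : R) (f : R -> R) (df : R) : derivable A r 1 ->
  is_derive r 1 f df ->
  is_derive r 1 (fun t => (a + b * expR (A t)) * f t)
    (b * expR (A r) * derive1 A r * f r + (a + b * expR (A r)) * df).
Proof.
move=> dA df'.
have dA1 : is_derive r 1 A (derive1 A r) by rewrite derive1E; exact: derivableP.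
have dE : is_derive r 1 (expR \o A) (expR (A r) * derive1 A r).
  exact: is_derive1_comp.
have dM := is_deriveM (is_deriveD (is_derive_cst a r 1)
  (is_deriveM (is_derive_cst b r 1) dE)) df'.
apply: is_derive_eq dM _.
by rewrite /GRing.scale !fctE /=; ring.
Qed.

Lemma metric_entry_is_derive mu nu r : derivable A r 1 ->
  is_derive r 1 (metric_entry mu nu)
   ((- (lightlike_pair mu nu)%:R
     + 2 * ((mu == ivarphi) && (nu == ivarphi))%:R * expR (A r)) * expR (A r) * derive1 A r).
Proof.
move=> dA.
have dA1 : is_derive r 1 A (derive1 A r) by rewrite derive1E; exact: derivableP.
have dE : is_derive r 1 (fun t => expR (A t)) (expR (A r) * derive1 A r).
  exact: is_derive1_comp.
apply: is_derive_eq (is_derive_affine_expR (- (lightlike_pair mu nu)%:R)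
  ((mu == ivarphi) && (nu == ivarphi))%:R _ _ _ dA dE) _.
by ring.
Qed.

(** * Christoffel symbols *)

Definition christoffel_const rho mu nu : bool :=
  [|| [&& rho == ir, mu == ir & nu == ir],
      [&& rho == ivarphi, mu == ir & nu == ivarphi] |
      [&& rho == ivarphi, mu == ivarphi & nu == ir]].

Definition christoffel_exp rho mu nu : bool :=
  [&& rho == iu, mu == ivarphi & nu == ivarphi].

Definition radial_christoffel rho mu nu (r : R) : R :=
  ((christoffel_const rho mu nu)%:R + (christoffel_exp rho mu nu)%:R * expR (A r))
  * derive1 A r.

Lemma partial_metric x s mu nu : derivable A (rcoord x) 1 ->
  partial s (fun y => dilaton_metric A y mu nu) x =
  (s == ir)%:R * ((- (lightlike_pair mu nu)%:R
     + 2 * ((mu == ivarphi) && (nu == ivarphi))%:R * expR (A (rcoord x)))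
     * expR (A (rcoord x)) * derive1 A (rcoord x)).
Proof.
move=> dA; rewrite (_ : (fun y => _) = fun y => metric_entry mu nu (rcoord y)).
  rewrite partial_radial derive1E.
  by rewrite (@derive_val _ _ _ _ _ _ _ (metric_entry_is_derive mu nu _ dA)).
by apply/funext => y; exact: dilaton_metricE.
Qed.

Lemma christoffel_dilaton_metric x rho mu nu : derivable A (rcoord x) 1 ->
  christoffel (dilaton_metric A) rho mu nu x = radial_christoffel rho mu nu (rcoord x).
Proof.
move=> dA; rewrite /christoffel sum_ord3 !ginv_dilaton_metric !partial_metric //.
rewrite /radial_christoffel; set e := expR _.
have e0 : e != 0 by rewrite gt_eqF ?expR_gt0.
by elim/ord3_ind: rho; elim/ord3_ind: mu; elim/ord3_ind: nu => /=; field.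
Qed.

Lemma radial_christoffel_is_derive rho mu nu r :
  derivable A r 1 -> derivable (derive1 A) r 1 ->
  is_derive r 1 (radial_christoffel rho mu nu)
   ((christoffel_exp rho mu nu)%:R * expR (A r) * derive1 A r ^+ 2
    + ((christoffel_const rho mu nu)%:R + (christoffel_exp rho mu nu)%:R * expR (A r))
      * derive1n 2 A r).
Proof.
move=> dA dA'.
have dA1 : is_derive r 1 (derive1 A) (derive1n 2 A r).
  by rewrite /= derive1E; exact: derivableP.
apply: is_derive_eq (is_derive_affine_expR (christoffel_const rho mu nu)%:R
  (christoffel_exp rho mu nu)%:R _ _ _ dA dA1) _.
by ring.
Qed.

(** * Curvature *)

Section OpenDomain.
Variable I : set R.
Hypotheses (openI : open I) (dA : forall r, I r -> derivable A r 1)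
  (dA' : forall r, I r -> derivable (derive1 A) r 1).

(** Differentiating a symbol requires its closed form on a whole neighbourhood of [x]; openness of
    [I] supplies it. *)
Lemma near_christoffel x rho mu nu : I (rcoord x) ->
  \forall y \near x, radial_christoffel rho mu nu (rcoord y) =
                     christoffel (dilaton_metric A) rho mu nu y.
Proof.
move=> Ix; near=> y; rewrite christoffel_dilaton_metric //; apply: dA.
by near: y; exact: near_rcoord.
Unshelve. all: by end_near. Qed.

Lemma derivable_christoffel x s rho mu nu : I (rcoord x) ->
  derivable (christoffel (dilaton_metric A) rho mu nu) x (dir R s).
Proof.
move=> Ix; apply: near_eq_derivable; first exact: near_christoffel.
by apply: derivable_radial => _; apply: ex_derive;
  apply: radial_christoffel_is_derive; [exact: dA|exact: dA'].
Qed.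

Lemma partial_christoffel x s rho mu nu : I (rcoord x) ->
  partial s (christoffel (dilaton_metric A) rho mu nu) x =
  (s == ir)%:R *
   ((christoffel_exp rho mu nu)%:R * expR (A (rcoord x)) * derive1 A (rcoord x) ^+ 2
    + ((christoffel_const rho mu nu)%:R
       + (christoffel_exp rho mu nu)%:R * expR (A (rcoord x)))
      * derive1n 2 A (rcoord x)).
Proof.
move=> Ix; rewrite -(@derive_val _ _ _ _ _ _ _
  (radial_christoffel_is_derive rho mu nu _ (dA _ Ix) (dA' _ Ix))).
rewrite -derive1E -partial_radial /partial.
by apply: esym; apply: near_eq_derive; exact: near_christoffel.
Qed.

(** In R_rr the derivative terms give A'' - 2A'' and the quadratic terms 2A'^2 - 2A'^2 cancel. The
    symbol A' e^A has upper index u, so its only derivative here is along u and vanishes. *)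
Lemma ricci_dilaton_metric x mu nu : I (rcoord x) ->
  ricci (dilaton_metric A) mu nu x =
  - ((mu == ir) && (nu == ir))%:R * derive1n 2 A (rcoord x).
Proof.
move=> Ix; rewrite /ricci !sum_ord3 !partial_christoffel //.
rewrite !christoffel_dilaton_metric; try exact: dA.
rewrite /radial_christoffel.
by elim/ord3_ind: mu; elim/ord3_ind: nu => /=; ring.
Qed.

Lemma scalar_curvature_dilaton_metric x : I (rcoord x) ->
  scalar_curvature (dilaton_metric A) x = 0.
Proof.
move=> Ix; rewrite /scalar_curvature !sum_ord3 !ricci_dilaton_metric //.
by rewrite !ginv_dilaton_metric /=; ring.
Qed.

End OpenDomain.

(** * Gradient, flux and box of the scalar field *)

Lemma grad_sq_radial x (phi : R -> R) :
  grad_sq (dilaton_metric A) (fun y => phi (rcoord y)) x = 0.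
Proof.
rewrite /grad_sq !sum_ord3 !partial_radial !ginv_dilaton_metric /=.
by ring.
Qed.

Lemma flux_radial mu (phi : R -> R) :
  flux (dilaton_metric A) (fun y => phi (rcoord y)) mu =
  fun y => - (mu == iu)%:R * expR (A (rcoord y)) * derive1 phi (rcoord y).
Proof.
apply/funext => x; rewrite /flux sum_ord3 !partial_radial !ginv_dilaton_metric /=.
rewrite /sqrt_det det_dilaton_metric opprK.
set e := expR _; have e0 : 0 < e by exact: expR_gt0.
(* As e^2 is nonnegative, the square root of -det g = e^4 is e^2. *)
rewrite (_ : e ^+ 4 = (e ^+ 2) ^+ 2) ?sqrtr_sqr ?ger0_norm ?sqr_ge0 //; last by ring.
have {}e0 : e != 0 by rewrite gt_eqF.
by elim/ord3_ind: mu => /=; field.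
Qed.

Lemma derivable_flux_radial mu x (phi : R -> R) :
  derivable (flux (dilaton_metric A) (fun y => phi (rcoord y)) mu) x (dir R mu).
Proof.
rewrite flux_radial.
apply: (@derivable_radial R (fun t => - (mu == iu)%:R * expR (A t) * derive1 phi t)).
(* Only the direction r leaves an obligation, and there the indicator of u makes the component
   zero. *)
move=> /eqP ->; rewrite (_ : (fun t => _) = cst 0); first exact: derivable_cst.
by apply/funext => t /=; rewrite oppr0 !mul0r.
Qed.

Lemma box_radial x (phi : R -> R) :
  box (dilaton_metric A) (fun y => phi (rcoord y)) x = 0.
Proof.
rewrite /box big1 ?mulr0 // => mu _; rewrite flux_radial.
rewrite (partial_radial R (fun t => - (mu == iu)%:R * expR (A t) * derive1 phi t)).
case: eqVneq => [->|_]; last by rewrite mul0r.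
rewrite (_ : (fun t => _) = cst 0) ?derive1_cst ?mulr0 //.
by apply/funext => t /=; rewrite oppr0 !mul0r.
Qed.

End DilatonMetric.

(** * The field equations *)

Theorem mainTheorem4 (R : realType) (I : set R) (A phi : R -> R)
    (openI : open I) (intervalI : is_interval I)
    (A_C2 : Ck_on 2 I A) (phi_C1 : Ck_on 1 I phi)
    (constraint : forall r : R, I r -> 2^-1 * (derive1 phi r) ^+ 2 = - derive1n 2 A r) :
  einstein_dilaton_solution (dilaton_metric A) (fun _ : R => 0)
    (fun x : spacetime R => phi (rcoord x)) [set x : spacetime R | I (rcoord x)].
Proof.
have dA r : I r -> derivable A r 1 by exact: A_C2.1 0%N r isT.
have dA' r : I r -> derivable (derive1 A) r 1 by exact: A_C2.1 1%N r isT.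
have dphi r : I r -> derivable phi r 1 by exact: phi_C1.1 0%N r isT.
move=> x /= Ix; split.
- split.
  + split.
      apply/matrixP => i j; rewrite mxE !dilaton_metricE.
      by elim/ord3_ind: i; elim/ord3_ind: j.
    by rewrite det_dilaton_metric oppr_lt0 exprn_gt0 ?expR_gt0.
  + move=> mu s t; rewrite (_ : (fun y => _) = fun y => metric_entry R A s t (rcoord y)).
      apply: derivable_radial => _; apply: ex_derive.
      by apply: metric_entry_is_derive; exact: dA.
    by apply/funext => y; exact: dilaton_metricE.
  + by move=> *; exact: derivable_christoffel openI dA dA' _ _ _ _ _ Ix.
  + split=> mu; last exact: derivable_flux_radial.
    by apply: derivable_radial => _; exact: dphi.
  + exact: derivable_cst.
- move=> mu nu.
  rewrite (ricci_dilaton_metric _ _ _ openI) // (scalar_curvature_dilaton_metric _ _ _ openI) //.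
  (* Moving the sign onto A'' lets the constraint replace -A'' by phi'^2 / 2, which matches the rr
     component; all other components read 0 = 0. *)
  rewrite grad_sq_radial !partial_radial mulNr -mulrN -(constraint (rcoord x) Ix).
  by elim/ord3_ind: mu; elim/ord3_ind: nu => /=; ring.
- by rewrite /dilaton_eq_at box_radial derive1_cst.
Qed.
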